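(* Let $n\ge2$ be an integer, let $m$ be the largest integer (strictly) less than $\sqrt{2n}$, and let $\mathbf X\in\mathbb R^{n\times2m}$ be the matrix $$\mathbf X=\sqrt{\frac n2}\begin{pmatrix}\mathbf 1_m^\top&\mathbf 1_m^\top\\ \mathbf I_m&-\mathbf I_m\\ \mathbf 0_{(n-m-1)\times m}&\mathbf 0_{(n-m-1)\times m}\end{pmatrix}.$$ Let $\boldsymbol\xi$ be a vector of $n$ i.i.d. Rademacher random variables, i.e. $\mathbf P(\boldsymbol\xi=\mathbf s)=2^{-n}$ for every $\mathbf s\in\{\pm1\}^n$, let $\boldsymbol\beta^*\in\mathbb R^{2m}$ be given by $\beta^*_1=\beta^*_{m+1}=1$ and $\beta^*_j=0$ for all other $j$, and let $\boldsymbol y=\mathbf X\boldsymbol\beta^*+\boldsymbol\xi$. Then for any $\lambda>0$ the Lasso $\widehat{\boldsymbol\beta}_\lambda$ satisfies $$\mathbf P\Big(\ell_n(\widehat{\boldsymbol\beta}_\lambda,\boldsymbol\beta^* )\ge\frac1{2\sqrt{2n}}\Big)\ge\frac12.$$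
   Context: $\widehat{\boldsymbol\beta}_\lambda$ is any element of $\arg\min_{\boldsymbol\beta\in\mathbb R^{2m}}\{\frac1{2n}\|\boldsymbol y-\mathbf X\boldsymbol\beta\|_2^2+\lambda\|\boldsymbol\beta\|_1\}$ (all solutions give the same $\mathbf X\widehat{\boldsymbol\beta}_\lambda$). The prediction loss is $\ell_n(\boldsymbol\beta,\boldsymbol\beta')=\frac1n\|\mathbf X(\boldsymbol\beta-\boldsymbol\beta')\|_2^2$. $\mathbf 1_m$ is the all-ones vector in $\mathbb R^m$, $\mathbf I_m$ the identity matrix. *)

(* Defs.v *)
(* MathComp / MathComp-Analysis. *)
From HB Require Import structures.
From mathcomp Require Import all_boot all_order all_algebra.
From mathcomp Require Import all_classical all_reals all_analysis.

Set Implicit Arguments.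
Unset Strict Implicit.
Unset Printing Implicit Defensive.

Import Order.TTheory GRing.Theory Num.Theory.

Local Open Scope classical_set_scope.
Local Open Scope ring_scope.

Definition norm1 (R : realType) (p : nat) (v : 'cV[R]_p) : R :=
  \sum_(j < p) `|v j 0|.

Definition norm2 (R : realType) (p : nat) (v : 'cV[R]_p) : R :=
  Num.sqrt (\sum_(j < p) v j 0 ^+ 2).

Definition lasso_objective (R : realType) (n p : nat) (X : 'M[R]_(n, p))
    (y : 'cV[R]_n) (lambda : R) (beta : 'cV[R]_p) : R :=
  (2 * n%:R)^-1 * norm2 (y - X *m beta) ^+ 2 + lambda * norm1 beta.

(* Any minimizer qualifies; minimizers need not be unique. *)
Definition is_lasso (R : realType) (n p : nat) (X : 'M[R]_(n, p))
    (y : 'cV[R]_n) (lambda : R) (beta : 'cV[R]_p) : Prop :=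
  forall b : 'cV[R]_p,
    lasso_objective X y lambda beta <= lasso_objective X y lambda b.

Definition prediction_loss (R : realType) (n p : nat) (X : 'M[R]_(n, p))
    (beta beta' : 'cV[R]_p) : R :=
  n%:R^-1 * norm2 (X *m (beta - beta')) ^+ 2.

Definition design_block (R : realType) (n m : nat) :
    'M[R]_(1 + (m + (n - m - 1)), m + m) :=
  col_mx (row_mx (const_mx 1) (const_mx 1))
 (col_mx (row_mx 1%:M         (- 1%:M))
         (row_mx 0            0)).

(* When m < n the block matrix has exactly n rows, and conform_mx only
   transports it to type 'M_(n, m + m) (see designE); the default 0 is used
   only when n <= m. *)
Definition design (R : realType) (n m : nat) : 'M[R]_(n, m + m) :=
  Num.sqrt (n%:R / 2) *: conform_mx 0 (design_block R n m).

Lemma design_rows (n m : nat) : (m < n)%N -> (1 + (m + (n - m - 1)) = n)%N.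
Proof. by move=> mn; rewrite addnA add1n -subnDA addn1 subnKC. Qed.

Lemma designE (R : realType) (n m : nat) (mn : (m < n)%N) :
  design R n m =
  Num.sqrt (n%:R / 2) *: castmx (design_rows mn, erefl) (design_block R n m).
Proof.
by rewrite /design -(conform_castmx (design_rows mn, erefl)) conform_mx_id.
Qed.

(* With 0-based indices, the entries equal to 1 are those at 0 and m. *)
Definition beta_star (R : realType) (m : nat) : 'cV[R]_(m + m) :=
  \col_(j < m + m) ((j == 0 :> nat) || (j == m :> nat))%:R.

Definition random_vector d (T : measurableType d) (R : realType)
    (P : probability T R) (n : nat) (xi : 'I_n -> {RV P >-> R}) (w : T) :
    'cV[R]_n :=
  \col_(i < n) xi i w.

Definition iid_rademacher d (T : measurableType d) (R : realType)
    (P : probability T R) (n : nat) (xi : 'I_n -> {RV P >-> R}) : Prop :=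
  forall s : 'cV[R]_n, (forall i, s i 0 = 1 \/ s i 0 = -1) ->
    P [set w | random_vector xi w = s] = (2 ^- n)%:E.

(* Main.v *)
Require Import Defs.
From HB Require Import structures.
From mathcomp Require Import all_boot all_order all_algebra.
From mathcomp Require Import all_classical all_reals all_analysis.
From mathcomp Require Import ring lra.

Set Implicit Arguments.
Unset Strict Implicit.
Unset Printing Implicit Defensive.

Import Order.TTheory GRing.Theory Num.Theory.

Local Open Scope classical_set_scope.
Local Open Scope ring_scope.

(** The loss bound is deterministic: it holds for every sign vector
  [xi], whatever minimizer the Lasso returns; the probability only enters
  through the fact that [xi] is almost surely a sign vector.

  Write a coefficient vector as [(a, b)], and let [S] be the sum of its
  coordinates, [D] the squared norm of [a - b], and [r = sqrt (n / 2)]. The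
  fit [X (a, b)] is [r (S, a - b, 0)], the target is [r (2, 0, 0)], and the loss
  is [((S - 2)^2 + D) / 2].  The l1 norm of [(a, b)] is at least [S], and any
  vector of differences [d] whose entries are at most [S / m] in absolute value
  can be produced with coordinate sum [S] and l1 norm exactly [S].  So an
  estimator that has [S] close to 2, as it must to predict the first row, can
  use the differences to fit the noise at no extra cost: competing with
  [d = s xi], where [s = min (S / m, 1 / r)], the Lasso cannot leave a larger
  residual on the middle rows, hence [D >= m s^2]
  (design_lasso_fits_noise).  As [m] lies between [2 r - 1] and [2 r], either
  value of [s] makes [(S - 2)^2 + D] at least [1 / (2 r)], that is, the loss is
  at least [1 / (4 r)] (scalar_loss_ge, design_loss_ge).

  It remains to see that the event in the theorem is measurable, although the
  selection of a minimizer is arbitrary. Comparing two Lasso solutions with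
  their midpoint shows that the fitted vector is a Lipschitz function of the
  response (lasso_lipschitz). So the event that the loss is below a threshold
  contains, with any outcome, all outcomes whose noise is close enough, and such
  an event is a countable union of preimages of rational boxes
  (measurable_initial_open, measurable_lasso_loss). *)

(** * Euclidean norm of column vectors *)

Section Euclidean.
Variables (R : realType) (p : nat).
Implicit Types u v : 'cV[R]_p.

Lemma sum_sqr_ge0 u : 0 <= \sum_j u j 0 ^+ 2.
Proof. by apply: sumr_ge0 => j _; exact: sqr_ge0. Qed.

Lemma norm2_ge0 u : 0 <= norm2 u.
Proof. exact: sqrtr_ge0. Qed.

Lemma norm2_sqr u : norm2 u ^+ 2 = \sum_j u j 0 ^+ 2.
Proof. by rewrite sqr_sqrtr ?sum_sqr_ge0. Qed.

Lemma norm2N u : norm2 (- u) = norm2 u.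
Proof. by congr Num.sqrt; apply: eq_bigr => j _; rewrite mxE sqrrN. Qed.

Lemma norm2Z (a : R) u : 0 <= a -> norm2 (a *: u) = a * norm2 u.
Proof.
move=> a0; rewrite /norm2 -[in RHS](ger0_norm a0) -sqrtr_sqr -sqrtrM ?sqr_ge0//.
by congr Num.sqrt; rewrite mulr_sumr; apply: eq_bigr => j _; rewrite mxE exprMn.
Qed.

Lemma norm2_sqrD u v :
  norm2 (u + v) ^+ 2
  = norm2 u ^+ 2 + 2 * (\sum_j u j 0 * v j 0) + norm2 v ^+ 2.
Proof.
rewrite !norm2_sqr mulr_sumr -!big_split; apply: eq_bigr => j _ /=.
by rewrite mxE; ring.
Qed.

(** Cauchy-Schwarz inequality, from the expansion of the squared norm of
  [|v|^2 u - <u, v> v]. *)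
Lemma dot_le_norm2 u v : \sum_j u j 0 * v j 0 <= norm2 u * norm2 v.
Proof.
set w := \sum_j _.
have [v0|v0] := eqVneq (norm2 v) 0.
  have /psumr_eq0P z : \sum_j v j 0 ^+ 2 = 0 by rewrite -norm2_sqr v0 expr0n.
  rewrite v0 mulr0 /w big1// => j _.
  have /eqP := z (fun i _ => sqr_ge0 (v i 0)) j isT.
  by rewrite sqrf_eq0 => /eqP->; rewrite mulr0.
have vp : 0 < norm2 v by rewrite lt0r v0 norm2_ge0.
have [//|h] := leP.
have e : norm2 (norm2 v ^+ 2 *: u - w *: v) ^+ 2
    = norm2 v ^+ 2 * (norm2 u ^+ 2 * norm2 v ^+ 2 - w ^+ 2).
  move: (norm2_sqr v); set V := norm2 v ^+ 2 => VE.
  transitivity (V ^+ 2 * norm2 u ^+ 2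
    + (- 2 * V * w) * (\sum_j u j 0 * v j 0) + w ^+ 2 * V); last first.
    by rewrite -/w; move: (norm2 u ^+ 2) => U; clearbody V w; ring.
  clearbody w; rewrite !norm2_sqr [X in _ = _ + _ ^+ 2 * X]VE !mulr_sumr -!big_split /=.
  by apply: eq_bigr => j _; rewrite !mxE; ring.
have := sqr_ge0 (norm2 (norm2 v ^+ 2 *: u - w *: v)).
rewrite e pmulr_rge0 ?exprn_gt0// -exprMn subr_ge0.
by rewrite ler_pXn2r// ?nnegrE ?mulr_ge0 ?norm2_ge0 ?(le_trans _ (ltW h))
  ?mulr_ge0 ?norm2_ge0// leNgt h.
Qed.

Lemma norm2D u v : norm2 (u + v) <= norm2 u + norm2 v.
Proof.
rewrite -(@ler_pXn2r _ 2) ?nnegrE ?addr_ge0 ?norm2_ge0// norm2_sqrD sqrrD.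
have := dot_le_norm2 u v; lra.
Qed.

End Euclidean.

Lemma norm2_le_sup (R : realType) p (u : 'cV[R]_p) (e : R) :
  (forall j, `|u j 0| <= e) -> norm2 u <= p%:R * e.
Proof.
case: p u => [|q] u ue.
  by rewrite /norm2 big_ord0 sqrtr0 mul0r.
have e0 : 0 <= e := le_trans (normr_ge0 _) (ue ord0).
rewrite -(@ler_pXn2r _ 2) ?nnegrE ?mulr_ge0 ?norm2_ge0// norm2_sqr.
apply: (@le_trans _ _ (\sum_(j < q.+1) e ^+ 2)).
  by apply: ler_sum => j _; rewrite -real_normK ?num_real// ler_pXn2r ?nnegrE.
rewrite sumr_const card_ord -(mulr_natl (e ^+ 2)) exprMn.
by rewrite ler_wpM2r ?sqr_ge0// -natrX ler_nat expnS leq_pmulr.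
Qed.

(** * Stability of the Lasso fit *)

Lemma norm1_midpoint (R : realType) p (b c : 'cV[R]_p) :
  norm1 (2^-1 *: (b + c)) <= (norm1 b + norm1 c) / 2.
Proof.
rewrite /norm1 -big_split /= mulr_suml ler_sum// => j _.
rewrite !mxE normrM ger0_norm ?invr_ge0// mulrC ler_wpM2r ?invr_ge0//.
exact: ler_normD.
Qed.

(** The midpoint [h] of [b] and [c] competes with both. By convexity the two
  penalties at [h] do not exceed those at [b] and [c], while moving to [h]
  changes each residual by half the difference [f] of the two fits; adding the
  two optimality inequalities leaves [|f|^2 <= 2 <y - z, f>]. With [y = z]
  this says that all Lasso solutions have the same fit. *)
Lemma lasso_lipschitz (R : realType) n p (X : 'M[R]_(n, p)) (y z : 'cV[R]_n)
    (lambda : R) (b c : 'cV[R]_p) :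
  (0 < n)%N -> 0 <= lambda ->
  is_lasso X y lambda b -> is_lasso X z lambda c ->
  norm2 (X *m b - X *m c) <= 2 * norm2 (y - z).
Proof.
move=> n0 l0 yb zc.
set f := X *m b - X *m c.
set h := 2^-1 *: (b + c).
have n2 : 0 < 2 * n%:R :> R by rewrite mulr_gt0// ltr0n.
have hb : y - X *m h = (y - X *m b) + 2^-1 *: f.
  rewrite /h /f -scalemxAr mulmxDr; apply/matrixP => i j; rewrite !mxE; lra.
have hc : z - X *m h = (z - X *m c) + (- 2^-1) *: f.
  rewrite /h /f -scalemxAr mulmxDr; apply/matrixP => i j; rewrite !mxE; lra.
have half : norm2 (2^-1 *: f) ^+ 2 = norm2 f ^+ 2 / 4.
  by rewrite norm2Z ?invr_ge0// exprMn; lra.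
have halfN : norm2 (- 2^-1 *: f) ^+ 2 = norm2 f ^+ 2 / 4.
  by rewrite scaleNr norm2N.
have key : 2 * norm2 f ^+ 2 <= 4 * (norm2 (y - z) * norm2 f).
  have mid := ler_wpM2l l0 (norm1_midpoint b c); rewrite -/h in mid.
  have := lerD (yb h) (zc h); rewrite /lasso_objective hb hc.
  rewrite (norm2_sqrD (y - X *m b)) (norm2_sqrD (z - X *m c)) half halfN => main.
  have dots : \sum_j (y - X *m b) j 0 * (2^-1 *: f) j 0 +
      \sum_j (z - X *m c) j 0 * (- 2^-1 *: f) j 0 =
      2^-1 * (\sum_j (y - z) j 0 * f j 0 - norm2 f ^+ 2).
    rewrite norm2_sqr -sumrB mulr_sumr -big_split /=; apply: eq_bigr => j _.
    by rewrite /f !mxE; lra.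
  have cs := dot_le_norm2 (y - z) f.
  have : 0 <= (2 * n%:R)^-1 * (2 * (2^-1 * (\sum_j (y - z) j 0 * f j 0
      - norm2 f ^+ 2)) + norm2 f ^+ 2 / 2).
    rewrite -dots; move: main mid; set k := _^-1; clearbody k; nra.
  rewrite pmulr_rge0 ?invr_gt0//. lra.
have [f0|f0] := eqVneq (norm2 f) 0.
  by rewrite f0 mulr_ge0 ?norm2_ge0.
have fp : 0 < norm2 f by rewrite lt0r f0 norm2_ge0.
rewrite -(ler_pM2r fp); lra.
Qed.

(** * Measurability of Lasso events *)

(** An event that is open for the initial topology of finitely many measurable
  functions is the union of the rational boxes it contains, of which there are
  countably many. *)
Lemma measurable_initial_open d (T : measurableType d) (R : realType) n
    (f : 'I_n -> T -> R) (U : set T) :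
  (forall i, measurable_fun setT (f i)) ->
  (forall w, U w -> exists2 e : R, 0 < e &
     forall w', (forall i, `|f i w' - f i w| < e) -> U w') ->
  measurable U.
Proof.
move=> mf openU.
pose box (q : {ffun 'I_n -> rat * rat}) : set T :=
  \bigcap_(i in [set: 'I_n]) f i @^-1` `]ratr (q i).1, ratr (q i).2[.
have mbox q : measurable (box q).
  apply: fin_bigcap_measurable => // i _.
  by rewrite -[X in measurable X]setTI; exact: mf.
have -> : U = \bigcup_q (if pselect (box q `<=` U) then box q else set0).
  apply/seteqP; split=> [w Uw|w [q _]]; last by case: pselect => // qU /qU.
  have [e e0 Ue] := openU w Uw.
  have lo i : exists q, ratr q \in `](f i w - e / 2), (f i w)[.
    by apply: rat_in_itvoo; rewrite ltrBlDr ltrDl divr_gt0.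
  have hi i : exists q, ratr q \in `](f i w), (f i w + e / 2)[.
    by apply: rat_in_itvoo; rewrite ltrDl divr_gt0.
  have [l lE] := choice lo; have [h hE] := choice hi.
  exists [ffun i => (l i, h i)] => //; case: pselect => [bU|nU].
    move=> i _ /=; rewrite ffunE in_itv /=.
    by move: (lE i) (hE i); rewrite !in_itv /= => /andP[_ l1] /andP[h1 _]; rewrite l1.
  exfalso; apply: nU => w' bw'; apply: Ue => i.
  have := bw' i I; rewrite /= ffunE /= in_itv /= => /andP[].
  move: (lE i) (hE i); rewrite !in_itv /= => /andP[l1 l2] /andP[h1 h2] b1 b2.
  by rewrite ltr_norml; apply/andP; split; lra.
apply: countable_bigcupT_measurable => // q.
by case: pselect => bU; [exact: mbox|exact: measurable0].
Qed.

(** The loss depends on [beta_hat] only through the fit, which is continuous in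
  the noise even where the selected minimizer jumps. *)
Lemma measurable_lasso_loss d (T : measurableType d) (R : realType) n p
    (X : 'M[R]_(n, p)) (mu : 'cV[R]_n) (xi : 'I_n -> T -> R) (lambda c : R)
    (beta_hat : T -> 'cV[R]_p) (beta : 'cV[R]_p) :
  (0 < n)%N -> 0 <= lambda -> (forall i, measurable_fun setT (xi i)) ->
  (forall w, is_lasso X (mu + \col_i xi i w) lambda (beta_hat w)) ->
  measurable [set w | c <= prediction_loss X (beta_hat w) beta].
Proof.
move=> n0 l0 mxi opt.
have -> : [set w | c <= prediction_loss X (beta_hat w) beta] =
    ~` [set w | prediction_loss X (beta_hat w) beta < c].
  by apply/seteqP; split=> w /=; rewrite leNgt => /negP.
have nR : 0 < n%:R :> R by rewrite ltr0n.
apply: measurableC; apply: (measurable_initial_open mxi) => w /= lossw.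
have c0 : 0 < c.
  by apply: le_lt_trans lossw; rewrite mulr_ge0 ?invr_ge0 ?sqr_ge0 ?ltW.
have lossE w' : (prediction_loss X (beta_hat w') beta < c) =
    (norm2 (X *m (beta_hat w' - beta)) < Num.sqrt (n%:R * c)).
  have nc : 0 <= n%:R * c by rewrite mulr_ge0 ?ltW.
  rewrite /prediction_loss ltr_pdivrMl// -[n%:R * c in LHS]sqr_sqrtr//.
  by rewrite ltr_pXn2r ?nnegrE ?norm2_ge0 ?sqrtr_ge0.
move: lossw; rewrite lossE; set N := norm2 _; set t := Num.sqrt _ => Nt.
(* The Lipschitz constant is 2 and the Euclidean norm is at most n times the
   sup norm, so this radius lets N grow by at most half of its distance to t. *)
exists ((t - N) / (4 * n%:R)) => [|w' close].
  by rewrite divr_gt0 ?subr_gt0// mulr_gt0.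
rewrite lossE -/t.
have step := lasso_lipschitz n0 l0 (opt w') (opt w).
have near : norm2 (mu + \col_i xi i w' - (mu + \col_i xi i w)) <= (t - N) / 4.
  have -> : (t - N) / 4 = n%:R * ((t - N) / (4 * n%:R)).
    by field; rewrite gt_eqF.
  apply: norm2_le_sup => i; rewrite !mxE.
  by rewrite opprD addrACA subrr add0r ltW// close.
have tri := norm2D (X *m beta_hat w' - X *m beta_hat w) (X *m (beta_hat w - beta)).
have -> : X *m (beta_hat w' - beta) =
    X *m beta_hat w' - X *m beta_hat w + X *m (beta_hat w - beta).
  by rewrite -mulmxBr -mulmxDr addrA subrK.
by rewrite -/N in tri; lra.
Qed.

(** * The design matrix in blocks *)

Lemma norm2_sqr_col_mx (R : realType) p q (u : 'cV[R]_p) (v : 'cV[R]_q) :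
  norm2 (col_mx u v) ^+ 2 = norm2 u ^+ 2 + norm2 v ^+ 2.
Proof.
rewrite !norm2_sqr big_split_ord /=.
by congr (_ + _); apply: eq_bigr => j _; rewrite ?col_mxEu ?col_mxEd.
Qed.

Lemma norm1_col_mx (R : realType) p q (u : 'cV[R]_p) (v : 'cV[R]_q) :
  norm1 (col_mx u v) = norm1 u + norm1 v.
Proof.
rewrite /norm1 big_split_ord /=.
by congr (_ + _); apply: eq_bigr => j _; rewrite ?col_mxEu ?col_mxEd.
Qed.

Definition coord_sum (R : realType) p (u : 'cV[R]_p) : R := \sum_j u j 0.

Lemma coord_sum_le_norm1 (R : realType) p (u : 'cV[R]_p) : coord_sum u <= norm1 u.
Proof. by apply: ler_sum => j _; exact: ler_norm. Qed.

Lemma coord_sumD (R : realType) p (u v : 'cV[R]_p) :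
  coord_sum (u + v) = coord_sum u + coord_sum v.
Proof. by rewrite /coord_sum -big_split; apply: eq_bigr => j _; rewrite mxE. Qed.

Lemma coord_sumN (R : realType) p (u : 'cV[R]_p) :
  coord_sum (- u) = - coord_sum u.
Proof. by rewrite /coord_sum -sumrN; apply: eq_bigr => j _; rewrite mxE. Qed.

(** With [n = 1 + (m + k)] rows the first row of [X] sees only the coordinate
  sum and the next [m] rows only the differences of paired coefficients. *)
Lemma design_mul_col_mx (R : realType) (m k : nat) (a b : 'cV[R]_m) :
  design R (1 + (m + k)) m *m col_mx a b =
  Num.sqrt ((1 + (m + k))%:R / 2)
    *: col_mx (const_mx (coord_sum (a + b))) (col_mx (a - b) 0).
Proof.
rewrite -scalemxAl; congr (_ *: _).
have -> : conform_mx 0 (design_block R (1 + (m + k)) m) =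
    col_mx (row_mx (const_mx 1) (const_mx 1))
      (col_mx (row_mx 1%:M (- 1%:M)) (row_mx 0 0)) :> 'M[R]_(1 + (m + k), m + m).
  rewrite /design_block.
  have -> : (1 + (m + k) - m - 1 = k)%N by rewrite -subnDA addnA [(1 + m)%N]addnC addKn.
  by rewrite conform_mx_id.
rewrite !mul_col_mx !mul_row_col !mul0mx addr0 mul1mx mulNmx mul1mx.
congr (col_mx _ _); rewrite -mulmxDr; apply/matrixP => i j.
by rewrite !mxE; apply: eq_bigr => l _; rewrite [in LHS]mxE mul1r (ord1 j).
Qed.

Lemma norm2_sign (R : realType) m (e : 'cV[R]_m) :
  (forall j, `|e j 0| = 1) -> norm2 e ^+ 2 = m%:R.
Proof.
move=> e1; rewrite norm2_sqr (eq_bigr (fun=> 1)) => [|j _].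
  by rewrite sumr_const card_ord.
by rewrite -real_normK ?num_real// e1 expr1n.
Qed.

Lemma beta_star_halves (R : realType) (m : nat) : (0 < m)%N ->
  exists e : 'cV[R]_m, beta_star R m = col_mx e e /\ coord_sum e = 1.
Proof.
case: m => // m _; exists (\col_j (j == 0 :> nat)%:R); split.
  apply/colP => j; rewrite mxE; case: (splitP j) => i ji.
    have -> : j = lshift _ i by apply: val_inj.
    by rewrite col_mxEu mxE /= [X in _ || X]ltn_eqF ?orbF.
  have -> : j = rshift _ i by apply: val_inj.
  by rewrite col_mxEd mxE /= -[X in _ == X]addn0 eqn_add2l.
by rewrite /coord_sum big_ord_recl mxE big1 ?addr0// => j _; rewrite mxE.
Qed.

(** * The Lasso fits the noise *)

(** The residual of [s e] is [(1 - r s) |e|]; a residual that is no larger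
  leaves, by the triangle inequality, at least [r s |e|] for [r d]. *)
Lemma norm2_ge_of_residual (R : realType) m (e d : 'cV[R]_m) (r s : R) :
  0 < r -> r * s <= 1 ->
  norm2 (e - r *: d) <= norm2 (e - r *: (s *: e)) ->
  s * norm2 e <= norm2 d.
Proof.
move=> r0 rs1 res; rewrite -(ler_pM2l r0).
have := norm2D (e - r *: d) (r *: d); rewrite subrK norm2Z ?(ltW r0)//.
have E : e - r *: (s *: e) = (1 - r * s) *: e by rewrite scalerA scalerBl scale1r.
have -> : r * (s * norm2 e) = norm2 e - (1 - r * s) * norm2 e by ring.
by move: res; rewrite E norm2Z ?subr_ge0//; lra.
Qed.

(** The competitor [(a', b')] keeps the coordinate sum [S], hence the first row
  of the fit, and replaces the differences by [s y1]. As
  [s |y1 j| <= S / m], its coordinates are nonnegative, so its l1 norm is [S],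
  which is at most that of [(a, b)]. Optimality then compares only the residuals of
  the middle rows. *)
Lemma design_lasso_fits_noise (R : realType) (m k : nat) (lambda s : R)
    (y0 : 'cV[R]_1) (y1 : 'cV[R]_m) (y2 : 'cV[R]_k) (a b : 'cV[R]_m) :
  let n := (1 + (m + k))%N in
  0 <= lambda -> (0 < m)%N -> (forall j, `|y1 j 0| <= 1) ->
  is_lasso (design R n m) (col_mx y0 (col_mx y1 y2)) lambda (col_mx a b) ->
  0 <= s -> m%:R * s <= coord_sum (a + b) -> Num.sqrt (n%:R / 2) * s <= 1 ->
  s * norm2 y1 <= norm2 (a - b).
Proof.
move=> n l0 m0 y1le opt s0 sS rs; set S := coord_sum (a + b) in sS *.
have n0 : 0 < n%:R :> R by rewrite ltr0n.
have r0 : 0 < Num.sqrt (n%:R / 2) :> R by rewrite sqrtr_gt0 divr_gt0.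
have m0R : 0 < m%:R :> R by rewrite ltr0n.
apply: norm2_ge_of_residual r0 rs _.
rewrite -(@ler_pXn2r _ 2) ?nnegrE ?norm2_ge0//.
(* Half sums are all S / (2 m) and half differences s y1 / 2. *)
pose a' := \col_j ((S / m%:R + s * y1 j 0) / 2).
pose b' := \col_j ((S / m%:R - s * y1 j 0) / 2).
have small j : `|s * y1 j 0| <= S / m%:R.
  rewrite normrM (ger0_norm s0) ler_pdivlMr// mulrC.
  by apply: le_trans sS; rewrite ler_wpM2l ?ler0n// ler_piMr.
have ab'B : a' - b' = s *: y1 by apply/colP => j; rewrite !mxE; lra.
have ab'S : coord_sum (a' + b') = S.
  rewrite /coord_sum (eq_bigr (fun=> S / m%:R)) => [|j _].
    by rewrite sumr_const card_ord -(mulr_natl (S / _)) mulrCA divff ?mulr1 ?gt_eqF.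
  by rewrite !mxE; lra.
have ab'1 : norm1 (col_mx a' b') = S.
  rewrite norm1_col_mx -ab'S coord_sumD; congr (_ + _); apply: eq_bigr => j _;
    rewrite ger0_norm// mxE divr_ge0//;
    by have := small j; rewrite ler_norml => /andP[]; lra.
have ab1 : S <= norm1 (col_mx a b).
  by rewrite /S coord_sumD norm1_col_mx lerD ?coord_sum_le_norm1.
have := opt (col_mx a' b'); rewrite /lasso_objective !design_mul_col_mx.
rewrite ab'S ab'B ab'1 !scale_col_mx !opp_col_mx !add_col_mx !norm2_sqr_col_mx.
rewrite -/S => opt'.
have : 0 < (2 * n%:R)^-1 :> R by rewrite invr_gt0 mulr_gt0.
have := ler_wpM2l l0 ab1.
move: opt'; rewrite -/n => opt' lS /ler_pM2l <-.
by rewrite !mulrDr in opt'; lra.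
Qed.

Lemma prediction_loss_design (R : realType) (m k : nat) (a b : 'cV[R]_m) :
  (0 < m)%N ->
  prediction_loss (design R (1 + (m + k)) m) (col_mx a b) (beta_star R m) =
  ((coord_sum (a + b) - 2) ^+ 2 + norm2 (a - b) ^+ 2) / 2.
Proof.
move=> /(beta_star_halves R)[e [-> e1]].
rewrite /prediction_loss opp_col_mx add_col_mx design_mul_col_mx.
rewrite norm2Z ?sqrtr_ge0// exprMn sqr_sqrtr ?divr_ge0// !norm2_sqr_col_mx.
have -> : a - e - (b - e) = a - b by rewrite opprB addrA subrK.
rewrite (_ : coord_sum _ = coord_sum (a + b) - 2); last first.
  by rewrite !coord_sumD coord_sumN e1; lra.
rewrite [norm2 (const_mx _) ^+ 2]norm2_sqr big_ord1 mxE.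
rewrite [norm2 (0 : 'cV_k) ^+ 2]norm2_sqr big1 ?addr0 => [|j _]; last first.
  by rewrite mxE expr0n.
by rewrite mulrA mulrA mulVf ?mul1r 1?mulrC// pnatr_eq0.
Qed.

(** Here [S] is the coordinate sum, [D] the squared norm of the
  differences, and [M] their number. If [S <= 0], the first square is at least
  4. If [0 < S <= M / r], take [s = S / M]:
  [(S - 2)^2 + S^2 / M] is at least [4 / (M + 1)]. If [S > M / r], take
  [s = 1 / r]: [D >= M / r^2 >= 1 / r]. *)
Lemma scalar_loss_ge (R : realFieldType) (M r S D : R) :
  1 <= r -> 0 < M -> M < 2 * r -> 2 * r <= M + 1 -> 0 <= D ->
  (forall s, 0 <= s -> M * s <= S -> r * s <= 1 -> M * s ^+ 2 <= D) ->
  1 <= 2 * r * ((S - 2) ^+ 2 + D).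
Proof.
move=> r1 M0 Mlt Mge D0 fit; have rp : 0 < r by lra.
have [S0|S0] := leP S 0.
  have : 4 <= (S - 2) ^+ 2 + D by nra.
  nra.
have [Sm|Sm] := leP (r * S) M.
  pose t := S / M; have St : S = M * t by rewrite mulrC divfK ?gt_eqF.
  have t0 : 0 <= t by rewrite divr_ge0 ?ltW.
  have DS : M * t ^+ 2 <= D.
    by apply: fit; rewrite -?St// -(ler_pM2l M0) mulr1 mulrCA -St.
  (* The square vanishes at the minimizer S = 2 M / (M + 1). *)
  have e : (M + 1) * ((S - 2) ^+ 2 + M * t ^+ 2) =
           4 + M * ((M + 1) * t - 2) ^+ 2 by rewrite St; ring.
  have sq0 := mulr_ge0 (ltW M0) (sqr_ge0 ((M + 1) * t - 2)).
  have : (M + 1) * ((S - 2) ^+ 2 + M * t ^+ 2) <= (M + 1) * ((S - 2) ^+ 2 + D).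
    by rewrite ler_wpM2l ?lerD2l ?addr_ge0 ?(ltW M0).
  nra.
have := fit r^-1; rewrite invr_ge0 (ltW rp) mulfV ?gt_eqF// ler_pdivrMr//.
rewrite mulrC => /(_ isT (ltW Sm) (lexx _)).
rewrite exprVn mulrC ler_pdivrMl ?exprn_gt0// => DS.
have rD : 1 <= r * D by rewrite -(ler_pM2l rp); lra.
have := mulr_ge0 (ltW rp) (sqr_ge0 (S - 2)); lra.
Qed.

Lemma design_loss_ge (R : realType) (m k : nat) (lambda : R)
    (xi : 'cV[R]_(1 + (m + k))) (beta : 'cV[R]_(m + m)) :
  let n := (1 + (m + k))%N in
  0 <= lambda -> (0 < m)%N ->
  m%:R < Num.sqrt (2 * n%:R) :> R -> Num.sqrt (2 * n%:R) <= m%:R + 1 :> R ->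
  2 <= Num.sqrt (2 * n%:R) :> R ->
  (forall i, `|xi i 0| = 1) ->
  is_lasso (design R n m) (design R n m *m beta_star R m + xi) lambda beta ->
  (2 * Num.sqrt (2 * n%:R))^-1 <=
  prediction_loss (design R n m) beta (beta_star R m).
Proof.
move=> n l0 m0; have [e [bsE _]] := beta_star_halves R m0.
rewrite -[beta]vsubmxK; set a := usubmx beta; set b := dsubmx beta.
rewrite -{2}(vsubmxK xi) -(vsubmxK (dsubmx xi)).
set x0 := usubmx xi; set x1 := usubmx (dsubmx xi); set x2 := dsubmx (dsubmx xi).
move=> mlt mge q2 xi1; rewrite prediction_loss_design//.
rewrite {1}bsE design_mul_col_mx subrr scale_col_mx add_col_mx.
rewrite scale_col_mx add_col_mx !scaler0 !add0r => opt.
have x1E j : `|x1 j 0| = 1 by rewrite !mxE xi1.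
have x1le j : `|x1 j 0| <= 1 by rewrite x1E.
have fit s := design_lasso_fits_noise l0 m0 x1le opt (s := s).
have N1 := norm2_sign x1E.
rewrite -/n in fit.
have qE : Num.sqrt (2 * n%:R) = 2 * Num.sqrt (n%:R / 2) :> R.
  rewrite (_ : 2 * n%:R = 2 ^+ 2 * (n%:R / 2)); last by lra.
  by rewrite sqrtrM ?sqr_ge0// sqrtr_sqr ger0_norm.
move: mlt mge q2 fit; rewrite qE; set r := Num.sqrt (n%:R / 2) => mlt mge q2 fit.
have m0R : 0 < m%:R :> R by rewrite ltr0n.
have rp : 0 < r by lra.
have {}fit s : 0 <= s -> m%:R * s <= coord_sum (a + b) -> r * s <= 1 ->
    m%:R * s ^+ 2 <= norm2 (a - b) ^+ 2.
  move=> s0 sS rs; rewrite -N1 -exprMn mulrC.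
  by rewrite ler_pXn2r ?nnegrE ?mulr_ge0 ?norm2_ge0 ?fit.
have := scalar_loss_ge _ m0R mlt mge (sqr_ge0 (norm2 (a - b))) fit.
have -> : 1 <= r by lra.
by move=> /(_ isT) loss; rewrite -div1r ler_pdivrMr; lra.
Qed.

(** * Rademacher noise *)

Definition sign_vector (R : realType) n (b : {ffun 'I_n -> bool}) : 'cV[R]_n :=
  \col_i (-1) ^+ b i.

Lemma sign_vector_pm (R : realType) n (b : {ffun 'I_n -> bool}) i :
  sign_vector R b i 0 = 1 \/ sign_vector R b i 0 = -1.
Proof. by rewrite mxE; case: (b i); [right|left]. Qed.

Lemma sign_vector_inj (R : realType) n : injective (@sign_vector R n).
Proof.
move=> b c /matrixP bc; apply/ffunP => i; have := bc i 0; rewrite !mxE.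
by case: (b i); case: (c i) => //= /eqP; rewrite -subr_eq0 => /eqP; lra.
Qed.

(** The [2^n] disjoint atoms of probability [2^-n] exhaust the total mass, so an
  event that contains them has probability one. *)
Lemma rademacher_sure d (T : measurableType d) (R : realType)
    (P : probability T R) n (xi : 'I_n -> {RV P >-> R}) (E : set T) :
  iid_rademacher xi -> measurable E ->
  (forall w, (forall i, xi i w = 1 \/ xi i w = -1) -> E w) ->
  P E = 1%E.
Proof.
move=> hxi mE FE.
pose F b := [set w | random_vector xi w = sign_vector R b].
have mF b : measurable (F b).
  have -> : F b = \bigcap_(i in [set: 'I_n]) xi i @^-1` [set sign_vector R b i 0].
    apply/seteqP; split=> w => [Fw i _|Fw] /=; first by rewrite -Fw mxE.
    by apply/colP => i; rewrite mxE; exact: Fw.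
  apply: fin_bigcap_measurable => //.
have tF : trivIset setT F.
  by move=> b c _ _ [w [/= wb wc]]; apply: (@sign_vector_inj R); rewrite -wb.
have PF : P (\bigcup_b F b) = 1%E.
  rewrite measure_fin_bigcup//.
  rewrite (eq_fsbigr (fun=> (2 ^- n)%:E)) => [|b _]; last first.
    by apply: hxi => i; exact: sign_vector_pm.
  have -> : [set: {ffun 'I_n -> bool}] = [set` enum {ffun 'I_n -> bool}].
    by apply/seteqP; split=> b //= _; rewrite mem_enum.
  rewrite -fsbig_seq ?enum_uniq// big_enum sumEFin sumr_const.
  rewrite card_ffun card_bool card_ord -(mulr_natl _ (2 ^ n)) natrX mulfV//.
  exact: finite_finset.
apply/eqP; rewrite eq_le probability_le1//= -PF; apply: le_measure.
- by rewrite inE; apply: fin_bigcup_measurable.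
- by rewrite inE.
- move=> w [b _ wb]; apply: FE => i.
  have := congr1 (fun v : 'cV_n => v i 0) wb; rewrite mxE => ->.
  exact: sign_vector_pm.
Qed.

Theorem proposition4 (R : realType) (n m : nat)
  (hn : (2 <= n)%N)
  (hm : m%:R < Num.sqrt (2 * n%:R) :> R)
  (hmax : forall k : int, k%:~R < Num.sqrt (2 * n%:R) :> R -> k <= m%:Z)
  (d : measure_display) (T : measurableType d) (P : probability T R)
  (xi : 'I_n -> {RV P >-> R}) (hxi : iid_rademacher xi)
  (lambda : R) (hlambda : 0 < lambda)
  (beta_hat : T -> 'cV[R]_(m + m))
  (hbeta : forall w : T,
     is_lasso (design R n m)
       (design R n m *m beta_star R m + random_vector xi w)
       lambda (beta_hat w)) :
  ((2^-1 : R)%:E <=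
   P [set w | ((2 * Num.sqrt (2 * n%:R))^-1 <=
               prediction_loss (design R n m) (beta_hat w) (beta_star R m))%R])%E.
Proof.
have nR : 2 <= n%:R :> R by rewrite ler_nat.
have q2 : 2 <= Num.sqrt (2 * n%:R) :> R.
  rewrite -(@ler_pXn2r _ 2) ?nnegrE ?sqrtr_ge0// sqr_sqrtr; lra.
have m0 : (0 < m)%N by have := hmax 1; rewrite -lez_nat; apply; lra.
have mge : Num.sqrt (2 * n%:R) <= m%:R + 1 :> R.
  rewrite leNgt; apply/negP => h.
  have := hmax (m + 1)%:Z; rewrite -pmulrn natrD => /(_ h).
  by rewrite lez_nat addn1 ltnn.
have mn : (m < n)%N.
  rewrite ltnNge; apply/negP; rewrite -(ler_nat R) => nm.
  have := sqr_sqrtr (_ : 0 <= 2 * n%:R :> R) => /(_ ltac:(lra)).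
  move: hm; set q := Num.sqrt _; nra.
have nE : n = (1 + (m + (n - m.+1)))%N by rewrite addnA add1n subnKC.
move: (n - m.+1)%N nE => k nE; subst n.
rewrite (rademacher_sure hxi).
- by rewrite lee_fin; lra.
- exact: measurable_lasso_loss (ltW hlambda) _ hbeta.
- move=> w pm /=.
  apply: design_loss_ge (ltW hlambda) m0 hm mge q2 _ (hbeta w) => i.
  by rewrite mxE; case: (pm i) => ->; rewrite ?normrN normr1.
Qed.
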